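(* Let $\alpha,\beta,\gamma,\delta,\lambda,\rho$ be real constants with $\rho\neq 0$ and $\delta\neq 0,1$, and let $f=f(x,u)$ be an arbitrary function. Then the equation $$u_t+\tfrac12\rho^2x^{2\gamma}u_{xx}+(\alpha+\beta x-\lambda\rho x^{\delta})u_x-f(x,u)=0,\qquad u=u(x,t),\ x>0,$$ can be transformed by an (invertible) point transformation to a heat equation with nonlinear source $$\hat u_{\hat t}=\hat u_{\hat x\hat x}+\hat f(\hat x,\hat u)$$ for some function $\hat f$ of $(\hat x,\hat u)$.
   Context: All variables are real and $x>0$. The point transformation is an invertible change of variables of the form $\hat x=X(x)$, $\hat t=\Psi(t)$, $\hat u=\Phi(x,u)$, which maps solutions of the first equation to solutions of the second one and conversely. Functions are assumed smooth. *)

(* Defs.v *)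
From Stdlib Require Import Reals.
From Coquelicot Require Import Coquelicot.
Open Scope R_scope.

Definition open_2d (D : R -> R -> Prop) : Prop :=
  forall x y, D x y -> locally_2d D x y.

(* C^infinity on a set, which is open in every use below; the values of the
   total function outside the set are irrelevant. *)
Definition smooth_1d (I : R -> Prop) (g : R -> R) : Prop :=
  forall x, I x -> forall n, ex_derive_n g n x.

Definition smooth_2d (D : R -> R -> Prop) (g : R -> R -> R) : Prop :=
  forall x y, D x y -> forall n, ex_diff_n g n x y.

Definition image_half_line (X : R -> R) (y : R) : Prop :=
  exists x, 0 < x /\ X x = y.

(* An invertible smooth change of variables
     (x, t, u) |-> (X x, Psi t, Phi x u)
   from {x > 0} x R x R onto X(0, +oo) x R x R, given with its smooth inverse
     (y, s, v) |-> (Xinv y, Psiinv s, Phiinv y v). *)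
Record point_transformation : Type := PointTransformation {
  X : R -> R;
  Psi : R -> R;
  Phi : R -> R -> R;
  Xinv : R -> R;
  Psiinv : R -> R;
  Phiinv : R -> R -> R;
  image_open : open (image_half_line X);
  X_smooth : smooth_1d (fun x => 0 < x) X;
  Psi_smooth : smooth_1d (fun _ => True) Psi;
  Phi_smooth : smooth_2d (fun x _ => 0 < x) Phi;
  Xinv_smooth : smooth_1d (image_half_line X) Xinv;
  Psiinv_smooth : smooth_1d (fun _ => True) Psiinv;
  Phiinv_smooth : smooth_2d (fun y _ => image_half_line X y) Phiinv;
  XK : forall x, 0 < x -> Xinv (X x) = x;
  PsiK : forall t, Psiinv (Psi t) = t;
  PsiinvK : forall s, Psi (Psiinv s) = s;
  PhiK : forall x u, 0 < x -> Phiinv (X x) (Phi x u) = u;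
  PhiinvK : forall x v, 0 < x -> Phi x (Phiinv (X x) v) = v
}.

(* Image of a set D of points (x, t), and of a function u = u(x, t). *)
Definition push_domain (T : point_transformation) (D : R -> R -> Prop)
  (y s : R) : Prop :=
  image_half_line (X T) y /\ D (Xinv T y) (Psiinv T s).

Definition push (T : point_transformation) (u : R -> R -> R) (y s : R) : R :=
  Phi T (Xinv T y) (u (Xinv T y) (Psiinv T s)).

Definition pull_domain (T : point_transformation) (D : R -> R -> Prop)
  (x t : R) : Prop :=
  0 < x /\ D (X T x) (Psi T t).

Definition pull (T : point_transformation) (v : R -> R -> R) (x t : R) : R :=
  Phiinv T (X T x) (v (X T x) (Psi T t)).

(* Image of a set of points (x, u). *)
Definition push_state (T : point_transformation) (Omega : R -> R -> Prop)
  (y v : R) : Prop :=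
  image_half_line (X T) y /\ Omega (Xinv T y) (Phiinv T y v).

(* In the two predicates below, the solution u = u(x, t) lives on an arbitrary
   open set D, and Omega is the set of points (x, u) where the source term is
   defined. *)
Definition solves_original (alpha beta gamma delta lambda rho : R)
  (Omega : R -> R -> Prop) (f : R -> R -> R)
  (D : R -> R -> Prop) (u : R -> R -> R) : Prop :=
  open_2d D /\ smooth_2d D u /\
  forall x t, D x t ->
    0 < x /\ Omega x (u x t) /\
    Derive (fun s => u x s) t
    + / 2 * rho ^ 2 * Rpower x (2 * gamma) * Derive_n (fun y => u y t) 2 x
    + (alpha + beta * x - lambda * rho * Rpower x delta)
      * Derive (fun y => u y t) x
    - f x (u x t) = 0.

Definition solves_heat (Omega : R -> R -> Prop) (f : R -> R -> R)
  (D : R -> R -> Prop) (u : R -> R -> R) : Prop :=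
  open_2d D /\ smooth_2d D u /\
  forall x t, D x t ->
    Omega x (u x t) /\
    Derive (fun s => u x s) t
    = Derive_n (fun y => u y t) 2 x + f x (u x t).

(* Main.v *)
Require Import Defs.
From Stdlib Require Import Reals Lra Lia.
From Coquelicot Require Import Coquelicot.
Open Scope R_scope.

(** Consider any equation [u_t + a(x) u_xx + b(x) u_x = f(x, u)] on the
    half-line and substitute [u(x, t) = w(x) v(X(x), -t)].  Reversing time turns
    the backward equation into a forward one, and the coefficients of [v_yy] and
    [v_y] become [a X'^2] and [a (2 w' X' / w + X'') + b X'].  The first is 1
    when [X' = a^(-1/2)]; the second then vanishes when
    [w' / w = - b / (2 a) - X'' / (2 X')].  What remains is a term [c(x) v]
    without derivatives, where [c = (a w'' + b w') / w], and it is absorbed into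
    the source.  This is [diffusion_reduces_to_heat].

    For [a = rho^2 x^(2 gamma) / 2] and [b = alpha + beta x - lambda rho x^delta]
    both ordinary differential equations only ask for primitives of powers of
    [x], so [X] and [log w] are explicit linear combinations of powers and, for
    exceptional exponents, a logarithm; [X] is inverted by a power or by the
    exponential.

    The substitution has to be made in both directions.  One identity
    ([pull_residual]) suffices, because a solution [u] of the original equation
    is itself the pull-back of its image under the transformation.

    Smoothness is iterated differentiability of the partial derivatives at a
    point, with continuity.  On an open set, being C^(n+1) is equivalent to
    being Frechet differentiable with partial derivatives of class C^n
    ([Ck_S_intro], [Ck_S_elim]), and in this form products and compositions
    follow by induction on [n]. *)

(** * Functions of class C^k on open sets of the plane *)

Definition d1 (f : R -> R -> R) (x y : R) : R := Derive (fun z => f z y) x.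
Definition d2 (f : R -> R -> R) (x y : R) : R := Derive (fun z => f x z) y.

Definition Ck (n : nat) (D : R -> R -> Prop) (f : R -> R -> R) : Prop :=
  forall x y, D x y -> ex_diff_n f n x y.

Definition continuous_on (D : R -> R -> Prop) (f : R -> R -> R) : Prop :=
  forall x y, D x y -> continuity_2d_pt f x y.

Lemma open_2d_preimage D E g h :
  open_2d D -> open_2d E -> continuous_on D g -> continuous_on D h ->
  open_2d (fun x y => D x y /\ E (g x y) (h x y)).
Proof.
intros oD oE cg ch x y [Dxy Egh].
destruct (oE _ _ Egh) as [e He].
apply locally_2d_and; [now apply oD|].
generalize (locally_2d_and _ _ _ _ (cg _ _ Dxy e) (ch _ _ Dxy e)).
apply locally_2d_impl, locally_2d_forall.
intros u v [Hg Hh]; now apply He.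
Qed.

(** The increment is split along a horizontal and a vertical segment, and the
    mean value theorem is applied on each. *)
Lemma differentiable_of_continuous_partials D f fx fy :
  open_2d D ->
  (forall x y, D x y -> is_derive (fun z => f z y) x (fx x y)) ->
  (forall x y, D x y -> is_derive (fun z => f x z) y (fy x y)) ->
  continuous_on D fx -> continuous_on D fy ->
  forall x y, D x y -> differentiable_pt_lim f x y (fx x y) (fy x y).
Proof.
intros oD Hx Hy cx cy x y Dxy eps.
assert (He : 0 < eps / 2) by (generalize (cond_pos eps); lra).
destruct (locally_2d_and _ _ _ _ (oD _ _ Dxy)
  (locally_2d_and _ _ _ _ (cx _ _ Dxy (mkposreal _ He))
     (cy _ _ Dxy (mkposreal _ He)))) as [d Hd]; simpl in Hd.
exists d; intros u v Hu Hv.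
assert (x0 : Rabs (x - x) < d)
  by (rewrite Rminus_diag, Rabs_R0; apply cond_pos).
destruct (MVT_cor4 (fun z => f z v) (fun z => fx z v) x (Rabs (u - x)))
  with (b := u) as [c [Ec Hc]]; [|lra|].
{ intros c Hc; apply Hx, Hd; lra. }
destruct (MVT_cor4 (fun z => f x z) (fun z => fy x z) y (Rabs (v - y)))
  with (b := v) as [e [Ee He']]; [|lra|].
{ intros e He'; apply Hy, Hd; lra. }
replace (f u v - f x y - (fx x y * (u - x) + fy x y * (v - y)))
  with ((fx c v - fx x y) * (u - x) + (fy x e - fy x y) * (v - y)) by lra.
destruct (Hd c v) as [_ [Hfx _]]; [lra|lra|].
destruct (Hd x e) as [_ [_ Hfy]]; [lra|lra|].
eapply Rle_trans; [apply Rabs_triang|]; rewrite !Rabs_mult.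
replace (eps * Rmax (Rabs (u - x)) (Rabs (v - y))) with
  (eps / 2 * Rmax (Rabs (u - x)) (Rabs (v - y))
   + eps / 2 * Rmax (Rabs (u - x)) (Rabs (v - y))) by field.
apply Rplus_le_compat; apply Rmult_le_compat; try apply Rabs_pos;
  try lra; auto using Rmax_l, Rmax_r.
Qed.

Lemma differentiable_pt_lim_partials f x y lx ly :
  differentiable_pt_lim f x y lx ly ->
  is_derive (fun z => f z y) x lx /\ is_derive (fun z => f x z) y ly.
Proof.
intros H; split; apply is_derive_Reals.
- replace lx with (lx * 1 + ly * 0) by ring.
  apply (derivable_pt_lim_comp_2d f (fun z => z) (fun _ => y)).
  + exact H.
  + apply derivable_pt_lim_id.
  + apply derivable_pt_lim_const.
- replace ly with (lx * 0 + ly * 1) by ring.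
  apply (derivable_pt_lim_comp_2d f (fun _ => x) (fun z => z)).
  + exact H.
  + apply derivable_pt_lim_const.
  + apply derivable_pt_lim_id.
Qed.

Lemma differentiable_pt_lim_continuous f x y lx ly :
  differentiable_pt_lim f x y lx ly -> continuity_2d_pt f x y.
Proof. intros H; apply differentiable_continuity_pt; now exists lx, ly. Qed.

Lemma Ck_continuous n D f : Ck n D f -> continuous_on D f.
Proof. intros H x y Dxy; specialize (H x y Dxy); destruct n; apply H. Qed.

Lemma Ck_0 D f : continuous_on D f -> Ck 0 D f.
Proof. intros H x y Dxy; split; auto. Qed.

Lemma Ck_ext n D f g :
  open_2d D -> (forall x y, D x y -> f x y = g x y) -> Ck n D f -> Ck n D g.
Proof.
intros oD E H x y Dxy; apply ex_diff_n_ext_loc with f; auto.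
generalize (oD _ _ Dxy); apply locally_2d_impl, locally_2d_forall; auto.
Qed.

Lemma Ck_pred n D f : Ck (S n) D f -> Ck n D f.
Proof. intros H x y Dxy; apply ex_diff_n_m with (S n); auto. Qed.

(** The hypothesis on [f] is Frechet differentiability, which yields at once the
    continuity and the two partial derivatives that the definition of the class
    asks for. *)
Lemma Ck_S_intro n D f fx fy :
  open_2d D ->
  (forall x y, D x y -> differentiable_pt_lim f x y (fx x y) (fy x y)) ->
  Ck n D fx -> Ck n D fy -> Ck (S n) D f.
Proof.
intros oD Hf Hfx Hfy x y Dxy.
destruct (differentiable_pt_lim_partials _ _ _ _ _ (Hf x y Dxy)) as [H1 H2].
assert (E : forall u v, D u v -> fx u v = d1 f u v /\ fy u v = d2 f u v).
{ intros u v Duv.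
  destruct (differentiable_pt_lim_unique _ _ _ _ _ (Hf u v Duv)) as [E1 E2].
  now split; symmetry. }
split; [apply (differentiable_pt_lim_continuous _ _ _ _ _ (Hf x y Dxy))|].
split; [eexists; exact H1|]; split; [eexists; exact H2|].
split.
- apply (Ck_ext n D fx (d1 f)); auto; intros; now apply E.
- apply (Ck_ext n D fy (d2 f)); auto; intros; now apply E.
Qed.

Lemma Ck_S_elim n D f :
  open_2d D -> Ck (S n) D f ->
  Ck n D (d1 f) /\ Ck n D (d2 f) /\
  forall x y, D x y -> differentiable_pt_lim f x y (d1 f x y) (d2 f x y).
Proof.
intros oD H.
assert (H1 : Ck n D (d1 f)) by (intros x y Dxy; apply (H x y Dxy)).
assert (H2 : Ck n D (d2 f)) by (intros x y Dxy; apply (H x y Dxy)).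
split; [|split]; auto.
apply (differentiable_of_continuous_partials D); auto.
- intros x y Dxy; apply Derive_correct; apply (H x y Dxy).
- intros x y Dxy; apply Derive_correct; apply (H x y Dxy).
- now apply Ck_continuous with n.
- now apply Ck_continuous with n.
Qed.

Lemma smooth_2d_Ck D f : smooth_2d D f <-> forall n, Ck n D f.
Proof. unfold smooth_2d, Ck; split; auto. Qed.

Lemma smooth_2d_elim D f :
  open_2d D -> smooth_2d D f ->
  smooth_2d D (d1 f) /\ smooth_2d D (d2 f) /\
  forall x y, D x y -> differentiable_pt_lim f x y (d1 f x y) (d2 f x y).
Proof.
intros oD H; rewrite !smooth_2d_Ck in *.
split; [|split].
- intros n; apply (Ck_S_elim n D f oD (H (S n))).
- intros n; apply (Ck_S_elim n D f oD (H (S n))).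
- apply (Ck_S_elim 0 D f oD (H 1%nat)).
Qed.

Lemma smooth_2d_continuous D f : smooth_2d D f -> continuous_on D f.
Proof. intros H x y Dxy; apply (H x y Dxy 0%nat). Qed.

Lemma smooth_2d_ext D f g :
  open_2d D -> (forall x y, D x y -> f x y = g x y) ->
  smooth_2d D f -> smooth_2d D g.
Proof.
rewrite !smooth_2d_Ck; intros oD E H n; now apply Ck_ext with f.
Qed.

(** * Closure properties *)

Lemma Ck_const n D c : open_2d D -> Ck n D (fun _ _ => c).
Proof.
intros oD; revert c; induction n as [|n IH]; intros c.
- apply Ck_0; intros x y _; apply continuity_2d_pt_const.
- apply Ck_S_intro with (fun _ _ => 0) (fun _ _ => 0); auto.
  intros x y _; apply differentiable_pt_lim_proj1_0.
  apply derivable_pt_lim_const.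
Qed.

Lemma smooth_2d_const D c : open_2d D -> smooth_2d D (fun _ _ => c).
Proof. rewrite smooth_2d_Ck; intros oD n; now apply Ck_const. Qed.

Lemma smooth_2d_snd D : open_2d D -> smooth_2d D (fun _ y => y).
Proof.
rewrite smooth_2d_Ck; intros oD [|n].
- apply Ck_0; intros x y _; apply continuity_2d_pt_id2.
- apply Ck_S_intro with (fun _ _ => 0) (fun _ _ => 1);
    auto using Ck_const.
  intros x y _ eps; apply locally_2d_forall; intros u v.
  replace (v - y - (0 * (u - x) + 1 * (v - y))) with 0 by ring.
  rewrite Rabs_R0; apply Rmult_le_pos; [apply Rlt_le, cond_pos|].
  eapply Rle_trans; [apply Rabs_pos|apply Rmax_l].
Qed.

Lemma differentiable_pt_lim_plus f g x y fx fy gx gy :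
  differentiable_pt_lim f x y fx fy -> differentiable_pt_lim g x y gx gy ->
  differentiable_pt_lim (fun u v => f u v + g u v) x y (fx + gx) (fy + gy).
Proof.
intros Hf Hg.
replace (fx + gx) with (1 * fx + 1 * gx) by ring.
replace (fy + gy) with (1 * fy + 1 * gy) by ring.
apply (differentiable_pt_lim_comp Rplus); auto.
apply (differentiable_of_continuous_partials (fun _ _ => True) Rplus
  (fun _ _ => 1) (fun _ _ => 1)); auto.
- intros ? ? _; now apply locally_2d_forall.
- intros ? ? _; auto_derive; auto.
- intros ? ? _; auto_derive; auto.
- intros ? ? _; apply continuity_2d_pt_const.
- intros ? ? _; apply continuity_2d_pt_const.
Qed.

Lemma differentiable_pt_lim_mult f g x y fx fy gx gy :
  differentiable_pt_lim f x y fx fy -> differentiable_pt_lim g x y gx gy ->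
  differentiable_pt_lim (fun u v => f u v * g u v) x y
    (fx * g x y + f x y * gx) (fy * g x y + f x y * gy).
Proof.
intros Hf Hg.
rewrite (Rmult_comm fx), (Rmult_comm fy).
apply (differentiable_pt_lim_comp Rmult); auto.
apply (differentiable_of_continuous_partials (fun _ _ => True) Rmult
  (fun _ v => v) (fun u _ => u)); auto.
- intros ? ? _; now apply locally_2d_forall.
- intros ? ? _; auto_derive; auto; ring.
- intros ? ? _; auto_derive; auto; ring.
- intros ? ? _; apply continuity_2d_pt_id2.
- intros ? ? _; apply continuity_2d_pt_id1.
Qed.

Lemma Ck_plus n D f g :
  open_2d D -> Ck n D f -> Ck n D g -> Ck n D (fun x y => f x y + g x y).
Proof.
intros oD; revert f g; induction n as [|n IH]; intros f g Hf Hg.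
- apply Ck_0; intros x y Dxy; apply continuity_2d_pt_plus;
    [now apply (Ck_continuous 0 D)|now apply (Ck_continuous 0 D)].
- destruct (Ck_S_elim n D f oD Hf) as [F1 [F2 F]].
  destruct (Ck_S_elim n D g oD Hg) as [G1 [G2 G]].
  eapply Ck_S_intro; [exact oD| | |].
  + intros x y Dxy; apply differentiable_pt_lim_plus; [now apply F|now apply G].
  + now apply IH.
  + now apply IH.
Qed.

Lemma Ck_mult n D f g :
  open_2d D -> Ck n D f -> Ck n D g -> Ck n D (fun x y => f x y * g x y).
Proof.
intros oD; revert f g; induction n as [|n IH]; intros f g Hf Hg.
- apply Ck_0; intros x y Dxy; apply continuity_2d_pt_mult;
    [now apply (Ck_continuous 0 D)|now apply (Ck_continuous 0 D)].
- destruct (Ck_S_elim n D f oD Hf) as [F1 [F2 F]].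
  destruct (Ck_S_elim n D g oD Hg) as [G1 [G2 G]].
  apply Ck_pred in Hf; apply Ck_pred in Hg.
  eapply Ck_S_intro; [exact oD| | |].
  + intros x y Dxy; apply differentiable_pt_lim_mult; [now apply F|now apply G].
  + now apply Ck_plus; auto; apply IH.
  + now apply Ck_plus; auto; apply IH.
Qed.

Lemma smooth_2d_plus D f g :
  open_2d D -> smooth_2d D f -> smooth_2d D g ->
  smooth_2d D (fun x y => f x y + g x y).
Proof. rewrite !smooth_2d_Ck; intros oD Hf Hg n; now apply Ck_plus. Qed.

Lemma smooth_2d_mult D f g :
  open_2d D -> smooth_2d D f -> smooth_2d D g ->
  smooth_2d D (fun x y => f x y * g x y).
Proof. rewrite !smooth_2d_Ck; intros oD Hf Hg n; now apply Ck_mult. Qed.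

(** The outer function changes in the induction on the order, since the chain
    rule replaces it by its partial derivatives; the inner functions stay. *)
Lemma smooth_2d_comp D E F g h :
  open_2d D -> open_2d E -> smooth_2d E F -> smooth_2d D g -> smooth_2d D h ->
  (forall x y, D x y -> E (g x y) (h x y)) ->
  smooth_2d D (fun x y => F (g x y) (h x y)).
Proof.
intros oD oE HF Hg Hh HE.
destruct (smooth_2d_elim D g oD Hg) as [G1 [G2 G]].
destruct (smooth_2d_elim D h oD Hh) as [H1 [H2 H]].
rewrite smooth_2d_Ck in *.
intros n; revert F HF; induction n as [|n IH]; intros F HF;
  destruct (smooth_2d_elim E F oE (proj2 (smooth_2d_Ck E F) HF)) as [F1 [F2 F']];
  rewrite smooth_2d_Ck in *.
- apply Ck_0; intros x y Dxy; eapply differentiable_pt_lim_continuous.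
  apply differentiable_pt_lim_comp; [now apply F', HE|now apply G|now apply H].
- eapply Ck_S_intro; [exact oD| | |].
  + intros x y Dxy.
    apply differentiable_pt_lim_comp; [now apply F', HE|now apply G|now apply H].
  + apply Ck_plus; auto; apply Ck_mult; auto; now apply IH.
  + apply Ck_plus; auto; apply Ck_mult; auto; now apply IH.
Qed.

(** * Functions of one variable *)

(** A function of one variable is treated as a function of two variables that
    depends only on the first; this transfers the closure properties above. *)
Definition strip (I : R -> Prop) (x _ : R) : Prop := I x.

Lemma open_strip I : open I -> open_2d (strip I).
Proof.
intros oI x y Ix; destruct (oI x Ix) as [e He]; exists e.
intros u v Hu _; exact (He u Hu).
Qed.

Lemma is_derive_strip (g : R -> R) x y l :
  is_derive g x l -> differentiable_pt_lim (fun u _ => g u) x y l 0.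
Proof.
intros H; apply differentiable_pt_lim_proj1_0; now apply is_derive_Reals.
Qed.

Lemma smooth_1d_of_strip I g :
  open I -> smooth_2d (strip I) (fun x _ => g x) -> smooth_1d I g.
Proof.
intros oI Hg x Ix [|n]; [exact Logic.I|].
assert (H : smooth_2d (strip I) (fun x _ => Derive_n g n x)).
{ clear x Ix; induction n as [|n IH]; [exact Hg|].
  exact (proj1 (smooth_2d_elim _ _ (open_strip I oI) IH)). }
apply (H x 0 Ix 1%nat).
Qed.

Lemma smooth_1d_Derive I g : smooth_1d I g -> smooth_1d I (Derive g).
Proof.
intros H x Ix [|n]; [exact Logic.I|].
apply ex_derive_ext with (Derive_n g (S n)); [|exact (H x Ix (S (S n)))].
intros t; replace (S n) with (n + 1)%nat by lia.
symmetry; exact (Derive_n_comp g n 1 t).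
Qed.

Lemma smooth_1d_is_derive I g x :
  smooth_1d I g -> I x -> is_derive g x (Derive g x).
Proof. intros H Ix; apply Derive_correct; exact (H x Ix 1%nat). Qed.

(** A coinduction principle: a family of functions that is stable under
    differentiation consists of smooth functions. *)
Lemma smooth_1d_coind I (P : (R -> R) -> Prop) :
  open I ->
  (forall g, P g -> exists g', P g' /\ forall x, I x -> is_derive g x (g' x)) ->
  forall g, P g -> smooth_1d I g.
Proof.
intros oI HP g Pg; apply smooth_1d_of_strip; auto.
apply smooth_2d_Ck; intros n; revert g Pg.
induction n as [|n IH]; intros g Pg; destruct (HP g Pg) as [g' [Pg' Hg]].
- apply Ck_0; intros x y Ix; eapply differentiable_pt_lim_continuous.
  now apply is_derive_strip, Hg.
- apply Ck_S_intro with (fun x _ => g' x) (fun _ _ => 0);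
    auto using open_strip, Ck_const.
  intros x y Ix; now apply is_derive_strip, Hg.
Qed.

Lemma smooth_2d_strip I g :
  open I -> smooth_1d I g -> smooth_2d (strip I) (fun x _ => g x).
Proof.
intros oI Hg; apply smooth_2d_Ck; intros n; revert g Hg.
induction n as [|n IH]; intros g Hg.
- apply Ck_0; intros x y Ix; eapply differentiable_pt_lim_continuous.
  now apply is_derive_strip, (smooth_1d_is_derive I).
- apply Ck_S_intro with (fun x _ => Derive g x) (fun _ _ => 0);
    auto using open_strip, Ck_const, smooth_1d_Derive.
  intros x y Ix; now apply is_derive_strip, (smooth_1d_is_derive I).
Qed.

Lemma smooth_2d_comp_1d D I k g :
  open_2d D -> open I -> smooth_1d I k -> smooth_2d D g ->
  (forall x y, D x y -> I (g x y)) -> smooth_2d D (fun x y => k (g x y)).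
Proof.
intros oD oI Hk Hg HI.
apply (smooth_2d_comp D (strip I) (fun u _ => k u) g g);
  auto using open_strip, smooth_2d_strip.
Qed.

Lemma smooth_1d_of_constant_derivative I g c :
  open I -> (forall x, I x -> is_derive g x c) -> smooth_1d I g.
Proof.
intros oI Hg.
apply smooth_1d_coind with
  (fun g => exists c, forall x, I x -> is_derive g x c); [exact oI| |now exists c].
clear g c Hg; intros g [c Hg]; exists (fun _ => c); split; [|exact Hg].
exists 0; intros x _; apply @is_derive_const.
Qed.

Lemma smooth_1d_linear I k : open I -> smooth_1d I (fun x => k * x).
Proof.
intros oI; apply smooth_1d_of_constant_derivative with k; auto.
intros x _; auto_derive; auto; ring.
Qed.

Lemma smooth_1d_const I c : open I -> smooth_1d I (fun _ => c).
Proof.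
intros oI; apply smooth_1d_of_constant_derivative with 0; auto.
intros x _; apply @is_derive_const.
Qed.

Lemma smooth_1d_opp : smooth_1d (fun _ => True) Ropp.
Proof.
apply smooth_1d_of_constant_derivative with (-1); [apply open_true|].
intros x _; auto_derive; auto; ring.
Qed.

Lemma smooth_1d_plus I f g :
  open I -> smooth_1d I f -> smooth_1d I g -> smooth_1d I (fun x => f x + g x).
Proof.
intros; apply smooth_1d_of_strip, smooth_2d_plus;
  auto using open_strip, smooth_2d_strip.
Qed.

Lemma smooth_1d_mult I f g :
  open I -> smooth_1d I f -> smooth_1d I g -> smooth_1d I (fun x => f x * g x).
Proof.
intros; apply smooth_1d_of_strip, smooth_2d_mult;
  auto using open_strip, smooth_2d_strip.
Qed.

Lemma smooth_1d_comp I J f g :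
  open I -> open J -> smooth_1d J f -> smooth_1d I g ->
  (forall x, I x -> J (g x)) -> smooth_1d I (fun x => f (g x)).
Proof.
intros oI oJ Hf Hg HJ; apply smooth_1d_of_strip; auto.
apply (smooth_2d_comp_1d (strip I) J f (fun x _ => g x));
  auto using open_strip, smooth_2d_strip.
Qed.

Lemma smooth_1d_exp : smooth_1d (fun _ => True) exp.
Proof.
apply smooth_1d_coind with (fun g => g = exp); [apply open_true| |reflexivity].
intros g ->; exists exp; split; auto; intros x _; apply is_derive_exp.
Qed.

Definition positive (x : R) : Prop := 0 < x.

Lemma open_positive : open positive.
Proof. apply open_gt. Qed.

(** Functions whose derivative is a multiple of a power form a family stable
    under differentiation; it contains the powers, the logarithm and all
    primitives of powers. *)
Lemma smooth_1d_of_power_derivative g c q :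
  (forall x, 0 < x -> is_derive g x (c * Rpower x q)) -> smooth_1d positive g.
Proof.
intros Hg; apply smooth_1d_coind with (fun g =>
  exists c q, forall x, 0 < x -> is_derive g x (c * Rpower x q));
  [exact open_positive| |now exists c, q].
clear g c q Hg; intros g [c [q Hg]].
exists (fun x => c * Rpower x q); split; auto.
exists (c * q), (q - 1); intros x x0; rewrite Rmult_assoc.
apply is_derive_Reals, derivable_pt_lim_scal.
now apply derivable_pt_lim_power.
Qed.

Lemma smooth_1d_Rpower p : smooth_1d positive (fun x => Rpower x p).
Proof.
apply smooth_1d_of_power_derivative with p (p - 1); intros x x0.
now apply is_derive_Reals, derivable_pt_lim_power.
Qed.

Lemma Rpower_m1 x : 0 < x -> Rpower x (-1) = / x.
Proof.
intros x0; replace (-1) with (- (1)) by ring.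
now rewrite Rpower_Ropp, Rpower_1.
Qed.

Lemma smooth_1d_inv I g :
  open I -> smooth_1d I g -> (forall x, I x -> 0 < g x) ->
  smooth_1d I (fun x => / g x).
Proof.
intros oI Hg Hpos; apply smooth_1d_of_strip; auto.
apply smooth_2d_ext with (fun x _ => Rpower (g x) (-1)).
- now apply open_strip.
- intros x y Ix; now apply Rpower_m1, Hpos.
- apply smooth_2d_strip; auto.
  apply (smooth_1d_comp I positive (fun u => Rpower u (-1)));
    auto using open_positive, smooth_1d_Rpower.
Qed.

(** * Reduction of a one-dimensional diffusion *)

Lemma smooth_1d_continuous_2d D I k :
  smooth_1d I k -> (forall x y, D x y -> I x) ->
  continuous_on D (fun x _ => k x).
Proof.
intros Hk HI x y Dxy; eapply differentiable_pt_lim_continuous.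
now apply is_derive_strip, (smooth_1d_is_derive I), HI with y.
Qed.

Lemma smooth_2d_lift D I g :
  open_2d D -> open I -> smooth_1d I g -> (forall x y, D x y -> I x) ->
  smooth_2d D (fun x _ => g x).
Proof.
intros oD oI Hg HI x y Dxy; apply (smooth_2d_strip I g oI Hg x y), (HI x y Dxy).
Qed.

Lemma smooth_2d_opp_snd D : open_2d D -> smooth_2d D (fun _ y => - y).
Proof.
intros oD.
apply (smooth_2d_comp_1d D (fun _ => True) Ropp (fun _ y => y));
  auto using open_true, smooth_1d_opp, smooth_2d_snd.
Qed.

(** The transformation whose pull-back is [v |-> w(x) v(X(x), -t)]. *)
Definition gauge_transformation (X Xinv w : R -> R)
  (oX : open (image_half_line X))
  (sX : smooth_1d positive X) (sXinv : smooth_1d (image_half_line X) Xinv)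
  (XK : forall x, 0 < x -> Xinv (X x) = x)
  (sw : smooth_1d positive w) (w0 : forall x, 0 < x -> 0 < w x) :
  point_transformation.
Proof.
assert (Xpos : forall y, image_half_line X y -> 0 < Xinv y).
{ intros y [x [x0 <-]]; now rewrite XK. }
refine (PointTransformation X Ropp (fun x u => / w x * u)
  Xinv Ropp (fun y v => w (Xinv y) * v) oX sX smooth_1d_opp _ sXinv
  smooth_1d_opp _ XK Ropp_involutive Ropp_involutive _ _).
- apply smooth_2d_mult; [apply (open_strip positive), open_positive| |].
  + apply (smooth_2d_strip positive), smooth_1d_inv; auto using open_positive.
  + exact (smooth_2d_snd _ (open_strip positive open_positive)).
- apply smooth_2d_mult; [now apply (open_strip (image_half_line X))| |].
  + apply (smooth_2d_strip (image_half_line X)); auto.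
    now apply (smooth_1d_comp _ positive w Xinv); auto using open_positive.
  + now apply smooth_2d_snd, (open_strip (image_half_line X)).
- intros x u x0; rewrite XK by auto; field.
  now apply Rgt_not_eq, w0.
- intros x u x0; rewrite XK by auto; field.
  now apply Rgt_not_eq, w0.
Defined.

(** The original equation with arbitrary coefficients; it is stated so that the
    original equation is an instance of it by conversion. *)
Definition solves_diffusion (a b : R -> R)
  (Omega : R -> R -> Prop) (f : R -> R -> R)
  (D : R -> R -> Prop) (u : R -> R -> R) : Prop :=
  open_2d D /\ smooth_2d D u /\
  forall x t, D x t ->
    0 < x /\ Omega x (u x t) /\
    Derive (fun s => u x s) t + a x * Derive_n (fun y => u y t) 2 x
    + b x * Derive (fun y => u y t) x - f x (u x t) = 0.

Lemma is_derive_comp_first (D : R -> R -> Prop) V (k : R -> R) s x k' :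
  open_2d D -> smooth_2d D V -> is_derive k x k' -> D (k x) s ->
  is_derive (fun z => V (k z) s) x (d1 V (k x) s * k').
Proof.
intros oD HV Hk Dk; apply is_derive_Reals.
replace (d1 V (k x) s * k') with (d1 V (k x) s * k' + d2 V (k x) s * 0) by ring.
apply (derivable_pt_lim_comp_2d V k (fun _ => s)).
- now apply (smooth_2d_elim D V).
- now apply is_derive_Reals.
- apply derivable_pt_lim_const.
Qed.

Lemma open_2d_pull_domain X D :
  smooth_1d positive X -> open_2d D ->
  open_2d (fun x t => 0 < x /\ D (X x) (- t)).
Proof.
intros sX oD.
apply (open_2d_preimage (strip positive) D (fun x _ => X x) (fun _ t => - t));
  auto.
- apply open_strip, open_positive.
- now apply (smooth_1d_continuous_2d _ positive).
- apply smooth_2d_continuous, smooth_2d_opp_snd, open_strip, open_positive.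
Qed.

(** The residual of the original equation at a pulled back function is [- w]
    times the residual of the heat equation.  The hypotheses on [X] and [w] are
    the two differential equations that normalize the coefficients of [v_yy] and
    [v_y], and [c] is the coefficient of the remaining term in [v]. *)
Lemma pull_residual (a b X w : R -> R) (c : R) (D : R -> R -> Prop)
  (v : R -> R -> R) x t :
  smooth_1d positive X -> smooth_1d positive w ->
  a x * Derive X x ^ 2 = 1 ->
  a x * (2 * Derive w x * Derive X x + w x * Derive_n X 2 x)
    + b x * w x * Derive X x = 0 ->
  c * w x = a x * Derive_n w 2 x + b x * Derive w x ->
  open_2d D -> smooth_2d D v -> 0 < x -> D (X x) (- t) ->
  Derive (fun s => w x * v (X x) (- s)) t
  + a x * Derive_n (fun y => w y * v (X y) (- t)) 2 x
  + b x * Derive (fun y => w y * v (X y) (- t)) x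
  = - w x * (Derive (fun s => v (X x) s) (- t)
             - Derive_n (fun y => v y (- t)) 2 (X x) - c * v (X x) (- t)).
Proof.
intros sX sw HX Hgauge Hc oD sv x0 Dx.
destruct (smooth_2d_elim D v oD sv) as [sv1 [sv2 dv]].
assert (sX1 := smooth_1d_Derive _ _ sX).
assert (sw1 := smooth_1d_Derive _ _ sw).
set (v1 := d1 v (X x) (- t)); set (v2 := d2 v (X x) (- t)).
set (v11 := d1 (d1 v) (X x) (- t)).
assert (dx : forall z, 0 < z -> D (X z) (- t) ->
  is_derive (fun y => w y * v (X y) (- t)) z
    (Derive w z * v (X z) (- t) + w z * (d1 v (X z) (- t) * Derive X z))).
{ intros z z0 Dz; apply (is_derive_mult w (fun y => v (X y) (- t)));
    [now apply (smooth_1d_is_derive positive)| |exact Rmult_comm].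
  apply (is_derive_comp_first D); auto; now apply (smooth_1d_is_derive positive). }
(* The first derivative is known on a neighbourhood of [x] because the pulled
   back domain is open. *)
assert (dxx : Derive_n (fun y => w y * v (X y) (- t)) 2 x =
  Derive_n w 2 x * v (X x) (- t) + Derive w x * (v1 * Derive X x)
  + (Derive w x * (v1 * Derive X x)
     + w x * (v11 * Derive X x * Derive X x + v1 * Derive_n X 2 x))).
{ simpl Derive_n.
  transitivity (Derive (fun z => Derive w z * v (X z) (- t)
    + w z * (d1 v (X z) (- t) * Derive X z)) x).
  - apply Derive_ext_loc.
    generalize (locally_2d_1d_const_y _ _ _
      (open_2d_pull_domain X D sX oD x t (conj x0 Dx))).
    apply filter_imp; intros z [z0 Dz]; now apply is_derive_unique, dx.
  - apply is_derive_unique.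
    apply (is_derive_plus (fun z => Derive w z * v (X z) (- t))
      (fun z => w z * (d1 v (X z) (- t) * Derive X z))).
    + apply (is_derive_mult (Derive w) (fun y => v (X y) (- t)));
        [now apply (smooth_1d_is_derive positive)| |exact Rmult_comm].
      apply (is_derive_comp_first D); auto; now apply (smooth_1d_is_derive positive).
    + apply (is_derive_mult w (fun z => d1 v (X z) (- t) * Derive X z));
        [now apply (smooth_1d_is_derive positive)| |exact Rmult_comm].
      apply (is_derive_mult (fun z => d1 v (X z) (- t)) (Derive X));
        [|now apply (smooth_1d_is_derive positive)|exact Rmult_comm].
      apply (is_derive_comp_first D (d1 v)); auto.
      now apply (smooth_1d_is_derive positive). }
assert (dt : Derive (fun s => w x * v (X x) (- s)) t = - w x * v2).
{ rewrite Derive_scal, (Derive_comp (fun s => v (X x) s) Ropp).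
  - rewrite (is_derive_unique Ropp t (-1)) by (auto_derive; auto; ring).
    unfold v2, d2; ring.
  - exists v2; exact (proj2 (differentiable_pt_lim_partials _ _ _ _ _ (dv _ _ Dx))).
  - auto_derive; auto. }
assert (dx0 : Derive (fun y => w y * v (X y) (- t)) x
  = Derive w x * v (X x) (- t) + w x * (v1 * Derive X x))
  by now apply is_derive_unique, dx.
rewrite dt, dxx, dx0.
change (Derive (fun s => v (X x) s) (- t)) with v2.
change (Derive_n (fun y => v y (- t)) 2 (X x)) with v11.
fold v1; set (V := v (X x) (- t)).
transitivity (- w x * v2 + w x * v11 * (a x * Derive X x ^ 2)
  + v1 * (a x * (2 * Derive w x * Derive X x + w x * Derive_n X 2 x)
          + b x * w x * Derive X x)
  + V * (a x * Derive_n w 2 x + b x * Derive w x)); [ring|].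
rewrite HX, Hgauge, <- Hc; ring.
Qed.

Definition reduces_to_heat (a b : R -> R) (Omega : R -> R -> Prop)
  (f : R -> R -> R) (T : point_transformation) (fhat : R -> R -> R) : Prop :=
  smooth_2d (push_state T Omega) fhat /\
  (forall D u, solves_diffusion a b Omega f D u ->
     solves_heat (push_state T Omega) fhat (push_domain T D) (push T u)) /\
  (forall D v, solves_heat (push_state T Omega) fhat D v ->
     solves_diffusion a b Omega f (pull_domain T D) (pull T v)).

(** Both halves use [pull_residual]: for the pull-back it is the equation itself,
    and for the image of [u] it is applied to [push T u], whose pull-back agrees
    with [u]. *)
Lemma diffusion_reduces_to_heat (a b X Xinv w : R -> R)
  (Omega : R -> R -> Prop) (f : R -> R -> R) :
  smooth_1d positive a -> smooth_1d positive b ->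
  open (image_half_line X) ->
  smooth_1d positive X -> smooth_1d (image_half_line X) Xinv ->
  (forall x, 0 < x -> Xinv (X x) = x) ->
  smooth_1d positive w -> (forall x, 0 < x -> 0 < w x) ->
  (forall x, 0 < x -> a x * Derive X x ^ 2 = 1) ->
  (forall x, 0 < x ->
     a x * (2 * Derive w x * Derive X x + w x * Derive_n X 2 x)
     + b x * w x * Derive X x = 0) ->
  open_2d Omega -> (forall x u, Omega x u -> 0 < x) -> smooth_2d Omega f ->
  exists T fhat, reduces_to_heat a b Omega f T fhat.
Proof.
intros sa sb oX sX sXinv XinvX sw w0 HX Hgauge oOmega Omega0 sf.
set (T := gauge_transformation X Xinv w oX sX sXinv XinvX sw w0).
set (c := fun x => (a x * Derive_n w 2 x + b x * Derive w x) * / w x).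
set (fhat := fun y v =>
  c (Xinv y) * v + (-1) * (f (Xinv y) (w (Xinv y) * v) * / w (Xinv y))).
exists T, fhat.
assert (Xinv0 : forall y, image_half_line X y -> 0 < Xinv y).
{ intros y [x [x0 <-]]; now rewrite XinvX. }
assert (XXinv : forall y, image_half_line X y -> X (Xinv y) = y).
{ intros y [x [x0 <-]]; now rewrite XinvX. }
assert (sc : smooth_1d positive c).
{ apply smooth_1d_mult, smooth_1d_inv; auto using open_positive.
  apply smooth_1d_plus; auto using open_positive;
    apply smooth_1d_mult; auto using open_positive, smooth_1d_Derive.
  exact (smooth_1d_Derive _ _ (smooth_1d_Derive _ _ sw)). }
assert (Hc : forall x, 0 < x ->
  c x * w x = a x * Derive_n w 2 x + b x * Derive w x).
{ intros x x0; unfold c; field; now apply Rgt_not_eq, w0. }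
assert (oim := open_strip _ oX).
assert (sback : smooth_2d (strip (image_half_line X))
  (fun y v => w (Xinv y) * v)).
{ exact (Phiinv_smooth T). }
assert (oPS : open_2d (push_state T Omega)).
{ apply (open_2d_preimage (strip (image_half_line X)) Omega
    (fun y _ => Xinv y) (fun y v => w (Xinv y) * v)); auto.
  - now apply (smooth_1d_continuous_2d _ (image_half_line X)).
  - now apply smooth_2d_continuous. }
assert (inPS : forall y v, push_state T Omega y v -> image_half_line X y).
{ intros y v H; apply H. }
assert (sXi : forall D, open_2d D -> (forall y v, D y v -> image_half_line X y) ->
  smooth_2d D (fun y _ => Xinv y)).
{ intros D oD HD; now apply smooth_2d_lift with (image_half_line X). }
assert (soX : forall D k, open_2d D ->
  (forall y v, D y v -> image_half_line X y) -> smooth_1d positive k ->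
  smooth_2d D (fun y _ => k (Xinv y))).
{ intros D k oD HD sk; apply (smooth_2d_comp_1d D positive k);
    auto using open_positive.
  intros y v Dyv; exact (Xinv0 _ (HD _ _ Dyv)). }
assert (swi : smooth_1d positive (fun x => / w x))
  by (apply smooth_1d_inv; auto using open_positive).
split; [|split].
- apply smooth_2d_plus; auto.
  + apply smooth_2d_mult; auto using smooth_2d_snd.
  + apply smooth_2d_mult; auto using smooth_2d_const.
    apply smooth_2d_mult; auto.
    * apply (smooth_2d_comp _ Omega f (fun y _ => Xinv y)
        (fun y v => w (Xinv y) * v)); auto.
      -- apply smooth_2d_mult; auto using smooth_2d_snd.
      -- intros y v H; apply H.
    * apply (soX _ (fun x => / w x)); auto.
- intros D u [oD [su Hu]].
  assert (oPD : open_2d (push_domain T D)).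
  { apply (open_2d_preimage (strip (image_half_line X)) D
      (fun y _ => Xinv y) (fun _ s => - s)); auto.
    - now apply (smooth_1d_continuous_2d _ (image_half_line X)).
    - now apply smooth_2d_continuous, smooth_2d_opp_snd. }
  assert (inPD : forall y s, push_domain T D y s -> image_half_line X y).
  { intros y s H; apply H. }
  assert (spu : smooth_2d (push_domain T D) (push T u)).
  { apply smooth_2d_mult; auto.
    - apply (soX _ (fun x => / w x)); auto.
    - apply (smooth_2d_comp _ D u (fun y _ => Xinv y) (fun _ s => - s));
        auto using smooth_2d_opp_snd.
      intros y s H; apply H. }
  split; [exact oPD|split; [exact spu|]].
  intros y s [Hy Dys]; simpl in Hy, Dys.
  assert (x0 := Xinv0 y Hy); set (x := Xinv y) in *.
  assert (Xx : X x = y) by now apply XXinv.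
  assert (Phi_u : w x * push T u y s = u x (- s)).
  { unfold push; simpl; fold x; field; now apply Rgt_not_eq, w0. }
  destruct (Hu x (- s) Dys) as [_ [Omu Equ]].
  split; [split; [exact Hy|]|].
  { change (Omega x (w x * push T u y s)); now rewrite Phi_u. }
  (* [u] is the pull-back of its image, so its derivatives are those that
     [pull_residual] computes. *)
  assert (E : forall z r, 0 < z -> u z r = w z * push T u (X z) (- r)).
  { intros z r z0; unfold push; simpl; rewrite XinvX, Ropp_involutive by auto.
    field; now apply Rgt_not_eq, w0. }
  assert (Et : Derive (fun r => u x r) (- s)
    = Derive (fun r => w x * push T u (X x) (- r)) (- s)).
  { apply Derive_ext; intros r; now apply E. }
  assert (loc : locally x (fun z => u z (- s) = w z * push T u (X z) (- - s))).
  { generalize (open_positive x x0); apply filter_imp.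
    intros z z0; now apply E. }
  assert (Ex : Derive (fun z => u z (- s)) x
    = Derive (fun z => w z * push T u (X z) (- - s)) x)
    by exact (Derive_ext_loc _ _ _ loc).
  assert (Exx : Derive_n (fun z => u z (- s)) 2 x
    = Derive_n (fun z => w z * push T u (X z) (- - s)) 2 x)
    by exact (Derive_n_ext_loc _ _ 2 _ loc).
  rewrite Et, Ex, Exx in Equ.
  rewrite (pull_residual a b X w (c x) (push_domain T D) (push T u)) in Equ;
    auto.
  + rewrite Xx, Ropp_involutive in Equ.
    unfold fhat; fold x; rewrite Phi_u.
    assert (wx := w0 x x0); apply (Rmult_eq_reg_l (w x)); [|lra].
    transitivity (w x * (Derive_n (fun y => push T u y s) 2 y
      + c x * push T u y s) - f x (u x (- s))); [lra|].
    field; lra.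
  + rewrite Xx, Ropp_involutive; split; auto.
- intros D v [oD [sv Hv]].
  assert (oPD := open_2d_pull_domain X D sX oD
    : open_2d (pull_domain T D)).
  assert (pullE : forall x t, 0 < x -> pull T v x t = w x * v (X x) (- t)).
  { intros x t x0; unfold pull; simpl; now rewrite XinvX. }
  split; [exact oPD|split].
  + apply smooth_2d_ext with (fun x t => w x * v (X x) (- t)); auto.
    { intros x t [x0 _]; symmetry; now apply pullE. }
    apply smooth_2d_mult; auto.
    * apply smooth_2d_lift with positive; auto using open_positive.
      intros x t H; apply H.
    * apply (smooth_2d_comp _ D v (fun x _ => X x) (fun _ t => - t));
        auto using smooth_2d_opp_snd.
      -- apply smooth_2d_lift with positive; auto using open_positive.
         intros x t H; apply H.
      -- intros x t H; apply H.
  + intros x t [x0 Dxt]; simpl in Dxt.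
    destruct (Hv _ _ Dxt) as [[_ Om] Eqv]; simpl in Om.
    rewrite XinvX in Om by auto.
    split; [exact x0|]; split; [now rewrite pullE|].
    rewrite (Derive_ext (fun s => pull T v x s) _ t
      (fun s => pullE x s x0)).
    assert (loc : locally x (fun z => pull T v z t = w z * v (X z) (- t))).
    { generalize (open_positive x x0); apply filter_imp.
      intros z z0; now apply pullE. }
    assert (Ex : Derive (fun z => pull T v z t) x
      = Derive (fun z => w z * v (X z) (- t)) x)
      by exact (Derive_ext_loc _ _ _ loc).
    assert (Exx : Derive_n (fun z => pull T v z t) 2 x
      = Derive_n (fun z => w z * v (X z) (- t)) 2 x)
      by exact (Derive_n_ext_loc _ _ 2 _ loc).
    rewrite Ex, Exx.
    rewrite (pull_residual a b X w (c x) D v), Eqv, pullE; auto.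
    unfold fhat; rewrite XinvX by auto; field; now apply Rgt_not_eq, w0.
Qed.

(** * Primitives of powers and their inverses *)

Definition power_primitive (p x : R) : R :=
  if Req_EM_T p (-1) then ln x else Rpower x (p + 1) / (p + 1).

Definition power_primitive_inv (p z : R) : R :=
  if Req_EM_T p (-1) then exp z else Rpower ((p + 1) * z) (/ (p + 1)).

Definition power_primitive_range (p z : R) : Prop := p = -1 \/ 0 < (p + 1) * z.

Lemma is_derive_power_primitive p x :
  0 < x -> is_derive (power_primitive p) x (Rpower x p).
Proof.
intros x0; unfold power_primitive; destruct (Req_EM_T p (-1)) as [-> | Hp].
- rewrite Rpower_m1 by auto; now apply is_derive_ln.
- apply is_derive_Reals.
  replace (Rpower x p) with
    ((p + 1) * Rpower x (p + 1 - 1) * / (p + 1) + Rpower x (p + 1) * 0).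
  + apply (derivable_pt_lim_mult (fun x => Rpower x (p + 1))
      (fun _ => / (p + 1))).
    * now apply derivable_pt_lim_power.
    * apply derivable_pt_lim_const.
  + replace (p + 1 - 1) with p by ring; field; lra.
Qed.

Lemma power_primitiveK p x :
  0 < x -> power_primitive_range p (power_primitive p x) /\
  power_primitive_inv p (power_primitive p x) = x.
Proof.
intros x0; unfold power_primitive_range, power_primitive, power_primitive_inv.
destruct (Req_EM_T p (-1)) as [Hp | Hp]; [split; [now left|now apply exp_ln]|].
replace ((p + 1) * (Rpower x (p + 1) / (p + 1))) with (Rpower x (p + 1))
  by (field; lra).
split; [right; apply exp_pos|].
rewrite Rpower_mult, Rinv_r by lra; now apply Rpower_1.
Qed.

Lemma power_primitive_invK p z :
  power_primitive_range p z ->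
  0 < power_primitive_inv p z /\ power_primitive p (power_primitive_inv p z) = z.
Proof.
unfold power_primitive_range, power_primitive, power_primitive_inv.
destruct (Req_EM_T p (-1)) as [Hp | Hp]; intros Hz;
  (split; [apply exp_pos|]); [apply ln_exp|].
destruct Hz as [Hz | Hz]; [easy|].
rewrite Rpower_mult, Rinv_l, Rpower_1 by lra; field; lra.
Qed.

Lemma open_power_primitive_range p : open (power_primitive_range p).
Proof.
unfold power_primitive_range; destruct (Req_EM_T p (-1)) as [Hp | Hp].
- apply open_ext with (fun _ => True); [tauto|apply open_true].
- apply open_or; [intros z Hz; easy|].
  apply (open_comp (fun z => (p + 1) * z) (fun u => 0 < u)); [|apply open_gt].
  intros z _; apply (continuous_mult (fun _ => p + 1) (fun z => z));
    [apply continuous_const|apply continuous_id].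
Qed.

Lemma smooth_1d_power_primitive_inv p :
  smooth_1d (power_primitive_range p) (power_primitive_inv p).
Proof.
assert (oJ := open_power_primitive_range p).
unfold power_primitive_inv; destruct (Req_EM_T p (-1)) as [Hp | Hp].
- intros z _; now apply smooth_1d_exp.
- apply (smooth_1d_comp _ positive (fun u => Rpower u (/ (p + 1)))
    (fun z => (p + 1) * z)); auto using open_positive, smooth_1d_Rpower,
    smooth_1d_linear.
  intros z [Hz | Hz]; [easy|exact Hz].
Qed.

Lemma is_derive_scal_Rpower c p x :
  0 < x ->
  is_derive (fun x => c * Rpower x p) x (c * (p * Rpower x (p - 1))).
Proof.
intros x0; apply is_derive_scal, is_derive_Reals.
now apply derivable_pt_lim_power.
Qed.

Lemma is_derive_scal_power_primitive c p x :
  0 < x -> is_derive (fun x => c * power_primitive p x) x (c * Rpower x p).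
Proof. intros x0; apply is_derive_scal; now apply is_derive_power_primitive. Qed.

Lemma smooth_1d_scal_power_primitive c p :
  smooth_1d positive (fun x => c * power_primitive p x).
Proof.
apply smooth_1d_of_power_derivative with c p; intros x x0.
now apply is_derive_scal_power_primitive.
Qed.

(** * Normalizing the diffusion coefficient *)

Definition diffusion (gamma rho x : R) : R :=
  / 2 * rho ^ 2 * Rpower x (2 * gamma).

Definition drift (alpha beta delta lambda rho x : R) : R :=
  alpha + beta * x - lambda * rho * Rpower x delta.

Lemma smooth_1d_diffusion gamma rho : smooth_1d positive (diffusion gamma rho).
Proof.
apply smooth_1d_of_power_derivative with
  (/ 2 * rho ^ 2 * (2 * gamma)) (2 * gamma - 1).
intros x x0; rewrite Rmult_assoc; now apply is_derive_scal_Rpower.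
Qed.

Lemma smooth_1d_drift alpha beta delta lambda rho :
  smooth_1d positive (drift alpha beta delta lambda rho).
Proof.
assert (o := open_positive).
apply (smooth_1d_plus positive (fun x => alpha + beta * x)
  (fun x => - (lambda * rho * Rpower x delta))); [exact o| |].
- apply (smooth_1d_plus positive (fun _ => alpha) (fun x => beta * x));
    [exact o|now apply smooth_1d_const|now apply smooth_1d_linear].
- apply smooth_1d_of_power_derivative with (- (lambda * rho * delta))
    (delta - 1); intros x x0.
  rewrite <- Ropp_mult_distr_l, Rmult_assoc.
  apply (is_derive_opp (fun x => lambda * rho * Rpower x delta)).
  now apply is_derive_scal_Rpower.
Qed.

(** Up to the constant [k], the primitive of [a^(-1/2)] (the Lamperti
    transform). *)
Definition flattening (gamma k x : R) : R := k * power_primitive (- gamma) x.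

Definition flattening_inv (gamma k y : R) : R :=
  power_primitive_inv (- gamma) (/ k * y).

Lemma flatteningK gamma k x :
  k <> 0 -> 0 < x -> flattening_inv gamma k (flattening gamma k x) = x.
Proof.
intros k0 x0; unfold flattening_inv, flattening.
rewrite <- Rmult_assoc, Rinv_l, Rmult_1_l by auto.
now apply power_primitiveK.
Qed.

Lemma image_flattening gamma k y :
  k <> 0 ->
  power_primitive_range (- gamma) (/ k * y)
  <-> image_half_line (flattening gamma k) y.
Proof.
intros k0; split.
- intros H; destruct (power_primitive_invK _ _ H) as [H1 H2].
  exists (flattening_inv gamma k y); split; [exact H1|].
  unfold flattening, flattening_inv; rewrite H2; field; auto.
- intros [x [x0 <-]]; unfold flattening.
  rewrite <- Rmult_assoc, Rinv_l, Rmult_1_l by auto.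
  now apply power_primitiveK.
Qed.

Lemma open_image_flattening gamma k :
  k <> 0 -> open (image_half_line (flattening gamma k)).
Proof.
intros k0; eapply open_ext; [intros y; now apply image_flattening|].
apply (open_comp (fun y => / k * y) (power_primitive_range (- gamma)));
  [|apply open_power_primitive_range].
intros y _; apply (continuous_mult (fun _ => / k) (fun y => y));
  [apply continuous_const|apply continuous_id].
Qed.

Lemma smooth_1d_flattening_inv gamma k :
  k <> 0 ->
  smooth_1d (image_half_line (flattening gamma k)) (flattening_inv gamma k).
Proof.
intros k0; assert (o := open_image_flattening gamma k k0).
apply (smooth_1d_comp _ (power_primitive_range (- gamma))
  (power_primitive_inv (- gamma)) (fun y => / k * y)).
- exact o.
- apply open_power_primitive_range.
- apply smooth_1d_power_primitive_inv.
- now apply smooth_1d_linear.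
- intros y; now apply image_flattening.
Qed.

Lemma Derive_flattening gamma k x :
  0 < x -> Derive (flattening gamma k) x = k * Rpower x (- gamma).
Proof.
intros x0; now apply is_derive_unique, is_derive_scal_power_primitive.
Qed.

Lemma Derive_2_flattening gamma k x :
  0 < x ->
  Derive_n (flattening gamma k) 2 x = k * (- gamma * Rpower x (- gamma - 1)).
Proof.
intros x0; simpl Derive_n.
transitivity (Derive (fun x => k * Rpower x (- gamma)) x).
- apply Derive_ext_loc; generalize (open_positive x x0).
  apply filter_imp; intros z z0; now apply Derive_flattening.
- now apply is_derive_unique, is_derive_scal_Rpower.
Qed.

Lemma flattening_unit_diffusion gamma rho k x :
  k ^ 2 * rho ^ 2 = 2 -> 0 < x ->
  diffusion gamma rho x * Derive (flattening gamma k) x ^ 2 = 1.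
Proof.
intros k2 x0; rewrite Derive_flattening by auto; unfold diffusion.
transitivity (/ 2 * (k ^ 2 * rho ^ 2)
  * Rpower x (2 * gamma + (- gamma + - gamma))).
- rewrite !Rpower_plus; ring.
- replace (2 * gamma + (- gamma + - gamma)) with 0 by ring.
  rewrite k2, Rpower_O by auto; field.
Qed.

(** * Removing the drift *)

(** This is [- b / (2 a) - X'' / (2 X')] for [X = flattening gamma k]: the first
    term is [- X'' / (2 X') = gamma / (2 x)], the others are [- b / (2 a)]
    expanded into powers. *)
Definition gauge_slope (alpha beta gamma delta lambda rho x : R) : R :=
  gamma / 2 * Rpower x (-1)
  + - alpha / rho ^ 2 * Rpower x (- (2 * gamma))
  + - beta / rho ^ 2 * Rpower x (1 - 2 * gamma)
  + lambda / rho * Rpower x (delta - 2 * gamma).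

(** The primitive of [gauge_slope]. *)
Definition gauge_exponent (alpha beta gamma delta lambda rho x : R) : R :=
  gamma / 2 * power_primitive (-1) x
  + - alpha / rho ^ 2 * power_primitive (- (2 * gamma)) x
  + - beta / rho ^ 2 * power_primitive (1 - 2 * gamma) x
  + lambda / rho * power_primitive (delta - 2 * gamma) x.

Definition gauge (alpha beta gamma delta lambda rho x : R) : R :=
  exp (gauge_exponent alpha beta gamma delta lambda rho x).

Lemma smooth_1d_gauge alpha beta gamma delta lambda rho :
  smooth_1d positive (gauge alpha beta gamma delta lambda rho).
Proof.
assert (o := open_positive).
apply (smooth_1d_comp positive (fun _ => True) exp);
  [exact o|apply open_true|apply smooth_1d_exp| |auto].
apply smooth_1d_plus;
  [exact o|apply smooth_1d_plus|apply smooth_1d_scal_power_primitive];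
  [exact o|apply smooth_1d_plus|apply smooth_1d_scal_power_primitive];
  [exact o| |]; apply smooth_1d_scal_power_primitive.
Qed.

Lemma Derive_gauge alpha beta gamma delta lambda rho x :
  0 < x ->
  Derive (gauge alpha beta gamma delta lambda rho) x
  = gauge_slope alpha beta gamma delta lambda rho x
    * gauge alpha beta gamma delta lambda rho x.
Proof.
intros x0; apply is_derive_unique.
apply (is_derive_comp exp); [apply is_derive_exp|].
do 3 (apply @is_derive_plus; [|now apply is_derive_scal_power_primitive]).
now apply is_derive_scal_power_primitive.
Qed.

Lemma gauge_cancels_drift alpha beta gamma delta lambda rho k x :
  rho <> 0 -> 0 < x ->
  let X := flattening gamma k in
  let w := gauge alpha beta gamma delta lambda rho in
  diffusion gamma rho x
    * (2 * Derive w x * Derive X x + w x * Derive_n X 2 x)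
  + drift alpha beta delta lambda rho x * w x * Derive X x = 0.
Proof.
intros rho0 x0 X w.
unfold X, w; rewrite Derive_gauge, Derive_flattening, Derive_2_flattening by auto.
generalize (gauge alpha beta gamma delta lambda rho x); intros W; clear X w.
unfold diffusion, drift, gauge_slope, Rminus.
replace (2 * gamma) with (gamma + gamma) by ring.
assert (G0 : Rpower x gamma <> 0) by apply Rgt_not_eq, exp_pos.
rewrite Ropp_plus_distr, !Rpower_plus, !Rpower_Ropp, Rpower_m1, Rpower_1 by auto.
revert G0; generalize (Rpower x gamma) (Rpower x delta); intros G S G0.
assert (x1 : x <> 0) by lra.
field; auto.
Qed.

Theorem mainTheorem1 :
  forall (alpha beta gamma delta lambda rho : R),
  rho <> 0 -> delta <> 0 -> delta <> 1 ->
  forall (Omega : R -> R -> Prop) (f : R -> R -> R),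
  open_2d Omega ->
  (forall x u, Omega x u -> 0 < x) ->
  smooth_2d Omega f ->
  exists (T : point_transformation) (fhat : R -> R -> R),
    smooth_2d (push_state T Omega) fhat /\
    (forall (D : R -> R -> Prop) (u : R -> R -> R),
       solves_original alpha beta gamma delta lambda rho Omega f D u ->
       solves_heat (push_state T Omega) fhat (push_domain T D) (push T u)) /\
    (forall (D : R -> R -> Prop) (v : R -> R -> R),
       solves_heat (push_state T Omega) fhat D v ->
       solves_original alpha beta gamma delta lambda rho Omega f
         (pull_domain T D) (pull T v)).
Proof.
intros alpha beta gamma delta lambda rho rho0 _ _ Omega f oOmega Omega0 sf.
(* [X' = k x^(-gamma)] must satisfy [a X'^2 = 1], that is, [k^2 rho^2 = 2]. *)
set (k := sqrt 2 / rho).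
assert (k2 : k ^ 2 * rho ^ 2 = 2).
{ unfold k; replace ((sqrt 2 / rho) ^ 2 * rho ^ 2) with (sqrt 2 * sqrt 2)
    by (field; auto).
  apply sqrt_sqrt; lra. }
assert (k0 : k <> 0) by (intros k0; rewrite k0 in k2; lra).
destruct (diffusion_reduces_to_heat (diffusion gamma rho)
  (drift alpha beta delta lambda rho) (flattening gamma k)
  (flattening_inv gamma k) (gauge alpha beta gamma delta lambda rho) Omega f)
  as [T [fhat H]].
- apply smooth_1d_diffusion.
- apply smooth_1d_drift.
- now apply open_image_flattening.
- apply smooth_1d_scal_power_primitive.
- now apply smooth_1d_flattening_inv.
- intros x x0; now apply flatteningK.
- apply smooth_1d_gauge.
- intros x _; apply exp_pos.
- intros x x0; now apply flattening_unit_diffusion.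
- intros x x0; now apply gauge_cancels_drift.
- exact oOmega.
- exact Omega0.
- exact sf.
- exists T, fhat; exact H.
Qed.
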